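(* Let $A,B\subseteq\mathbb{R}$ be closed sets of positive Lebesgue measure. Then $A\times B\subset\mathbb{R}^2$ is not $c$-removable.
   Context: For $U\subset\mathbb{R}^d$ open, a function $f:U\to\mathbb{R}$ is locally convex on $U$ if every point of $U$ has an open convex neighbourhood $V\subset U$ such that $f|_V$ is convex. A closed set $F\subset\mathbb{R}^d$ is $c$-removable if every function $f:\mathbb{R}^d\to\mathbb{R}$ which is continuous on $\mathbb{R}^d$ and locally convex on $\mathbb{R}^d\setminus F$ is convex on $\mathbb{R}^d$. *)

(* Defs.v *)
From mathcomp Require Import all_boot all_order all_algebra.
From mathcomp Require Import all_classical all_reals all_analysis.

Set Implicit Arguments.
Unset Strict Implicit.
Unset Printing Implicit Defensive.

Import Order.TTheory GRing.Theory Num.Theory.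
Import numFieldNormedType.Exports.

Local Open Scope classical_set_scope.
Local Open Scope ring_scope.

(* [convex_function V f] only constrains [f] at points of [V], so it says that
   the restriction of [f] to the convex set [V] is convex. *)
Definition locally_convex_on (R : realType) (d : nat)
    (U : set 'rV[R]_d) (f : 'rV[R]_d -> R) : Prop :=
  forall x, U x -> exists V : set 'rV[R]_d,
    [/\ open V, convex_set V, V x, V `<=` U & convex_function V f].

(* The notion is used for closed [F] only. Closedness is not a conjunct here, so
   that the negation always yields a continuous, locally convex, non-convex
   function. *)
Definition c_removable (R : realType) (d : nat) (F : set 'rV[R]_d) : Prop :=
  forall f : 'rV[R]_d -> R, continuous f -> locally_convex_on (~` F) f ->
    convex_function setT f.

Definition cartesian_product (R : realType) (A B : set R) : set 'rV[R]_2 :=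
  [set v : 'rV[R]_2 | A (v 0 0) /\ B (v 0 1)].

(* Main.v *)
Require Import Defs.
From mathcomp Require Import all_boot all_order all_algebra.
From mathcomp Require Import all_classical all_reals all_analysis.
From mathcomp Require Import measurable_realfun ring lra.
Import numFieldNormedType.Exports.

(** The counterexample to removability has the form
      f (x, y) = x^2 + y^2 + x y - (3/2) (G x + H y)
    where, almost everywhere, G'' is the indicator of A (or of a bounded part
    of A of positive measure) and H'' that of B.

    The mixed derivative of f is the constant 1, while f_xx is 1/2 on A and 2
    off A, and f_yy is 1/2 on B and 2 off B. At a point outside A x B at least
    one of the two equals 2 and the other is at least 1/2, so the determinant
    of the Hessian is at least 2 * 1/2 - 1 = 0. Moreover, if x is not in A,
    then G is affine near x because A is closed, so f is convex on a whole
    strip I x R around that point; the same goes for B. This part is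
    [convex_perturbed_quadratic]; with only one derivative of G at hand, it is
    run on first-order Taylor remainders and subgradients.

    On A x B, on the other hand, the second derivative of f in the direction
    (1, -1) is 1/2 + 1/2 - 2 < 0. As G'' is only known almost everywhere, this
    is made precise at a density point x0 of A and a density point y0 of B: by
    Lebesgue differentiation, there the quadratic growth of G and H is almost
    the maximal one ([density_potential]), and the second difference of f
    along (1, -1) is negative for a small step. *)

Set Implicit Arguments.
Unset Strict Implicit.
Unset Printing Implicit Defensive.

Import Order.TTheory GRing.Theory Num.Theory.
Local Open Scope classical_set_scope.
Local Open Scope ring_scope.

(** * Primitives of the indicator of a set *)

Section Measure.
Variable R : realType.
Notation mu := (@lebesgue_measure R).

Lemma exists_bounded_part_pos (A : set R) :
  measurable A -> (0 < mu A)%E ->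
  exists n : nat, (0 < mu (A `&` `[(- n%:R)%R, n%:R%R]))%E.
Proof.
move=> mA posA; apply: contrapT => noN.
suff : mu.-negligible A.
  by move/(negligibleP mu mA).1 => A0; move: posA; rewrite A0 ltxx.
rewrite -(setIT A) -(bigcup_itvT true false) setI_bigcupr.
apply: negligible_bigcup => n; apply/(negligibleP mu).
  exact: measurableI.
apply/eqP; rewrite -measure_le0 leNgt; apply/negP => pn; apply: noN.
by exists n.
Qed.

(** Vanishing near -oo makes [g] integrable on every left half-line, so that
    its integral from -oo is one antiderivative valid on the whole line. *)
Lemma antiderivative_of_left_vanishing (g : R -> R) (a : R) :
  continuous g -> (forall x, x <= a -> g x = 0) ->
  exists G : R -> R, forall x : R, is_derive x 1 G (g x).
Proof.
move=> cg g0.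
have ig (u : R) : mu.-integrable [set` `]-oo, u]] (EFin \o g).
  have ic : mu.-integrable `[a, u] (EFin \o g).
    apply: continuous_compact_integrable; first exact: segment_compact.
    exact: continuous_subspaceT.
  have ir : mu.-integrable setT ((EFin \o g) \_ `[a, u]).
    by apply: (integrable_mkcond _ _).1.
  have {}ir : mu.-integrable `]-oo, u] ((EFin \o g) \_ `[a, u]).
    exact: integrableS ir.
  apply: eq_integrable ir => // x; rewrite inE/= in_itv/= => xu.
  rewrite patchE; case: ifPn => //; rewrite notin_setE/= in_itv/= xu andbT.
  by move/negP; rewrite -ltNge => /ltW /g0 ->.
exists (fun x => \int[mu]_(t in [set` `]-oo, x]]) g t) => x.
have xu : x < x + 1 by rewrite ltrDl.
have [dG G'] := continuous_FTC1 xu (ig _) (ltNyr x) (cg x).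
by apply: DeriveDef => //; rewrite -derive1E.
Qed.

(** Here g x is the measure of the part of A to the left of x. By Lebesgue
    differentiation its derivative is the indicator of A almost everywhere,
    hence it is 1 at some point of A, as A is not negligible. *)
Lemma indicator_primitive (A : set R) :
  measurable A -> (0 < mu A)%E -> (exists n : nat, A `<=` `[- n%:R, n%:R]) ->
  exists (g : R -> R) (a x0 : R),
    [/\ forall x y, x <= y -> 0 <= g y - g x <= y - x,
        forall x y, x <= y -> `[x, y] `<=` ~` A -> g x = g y,
        forall x, x <= a -> g x = 0 &
        is_derive x0 1 g 1].
Proof.
move=> mA posA [n An].
have Afin : (mu A < +oo)%E.
  apply: (@le_lt_trans _ _ (mu `[(- n%:R)%R, n%:R%R])).
    by apply: le_measure => //; rewrite inE.
  by rewrite lebesgue_measure_itv/=; case: ifP => _; rewrite ltry.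
have iT : mu.-integrable setT (EFin \o (\1_A : R -> R)).
  apply/integrableP; split; first exact/measurable_EFinP/measurable_indic.
  under eq_integral => t _ do rewrite /= ger0_norm//.
  by rewrite integral_indic// setIT.
have iD (D : set R) : measurable D ->
    mu.-integrable D (EFin \o (\1_A : R -> R)).
  by move=> mD; exact: integrableS iT.
set g := fun x => \int[mu]_(t in [set` `]-oo, x]]) (\1_A t : R).
have gB x y : x <= y -> g y - g x = \int[mu]_(t in [set` `]x, y]]) \1_A t.
  by move=> xy; rewrite /g Rintegral_itvB//; exact: iD.
have [z [Az [dz z1]]] :
    exists z, A z /\ derivable g z 1 /\ g^`()%classic z = \1_A z.
  apply: contrapT => noz.
  have ae := FTC1Ny (fun y => iD _ (measurable_itv `]-oo, y]))
    (open_integrable_locally openT iT).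
  suff /(negligibleP mu mA).1 A0 : mu.-negligible A.
    by move: posA; rewrite A0 ltxx.
  by apply: negligibleS ae => z Az /= zg; apply: noz; exists z.
have int1 x y : x <= y -> \int[mu]_(t in [set` `]x, y]]) (1 : R) = y - x.
  move=> xy; rewrite Rintegral_cst// mul1r.
  have := lebesgue_measure_itv `]x, y]; rewrite /= lte_fin => ->.
  by case: ltgtP xy => // -> _; rewrite subrr.
exists g, (- n%:R - 1), z; split.
- move=> x y xy; rewrite gB//; apply/andP; split; first exact: Rintegral_ge0.
  rewrite -int1//; apply: le_Rintegral => //; first exact: iD.
  apply: measurable_bounded_integrable => //; last exact: bounded_cst.
  by rewrite /= lebesgue_measure_itv/=; case: ifP => _; rewrite ltry.
- move=> x y xy xyA; apply/esym/eqP; rewrite -subr_eq0 gB//.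
  rewrite (@eq_Rintegral _ _ _ mu _ (cst 0)) ?Rintegral_cst ?mul0r// => t.
  rewrite inE/= in_itv/= => /andP[xt ty].
  by rewrite indicE memNset//; apply: xyA; rewrite /= in_itv/= (ltW xt).
- move=> x xn; rewrite /g.
  rewrite (@eq_Rintegral _ _ _ mu _ (cst 0)) ?Rintegral_cst ?mul0r// => t.
  rewrite inE/= in_itv/= => tx.
  rewrite indicE memNset// => /An; rewrite /= in_itv/= => /andP[nt _].
  have := le_trans nt tx; lra.
- by apply: DeriveDef => //; rewrite -derive1E z1 indicE mem_set.
Qed.

End Measure.

(** * Second-order bounds on first-order Taylor remainders *)

Section Taylor.
Variable R : realType.

(** The mean value theorem, applied to G with its tangent line at u and the
    parabola k/2 (z - u)^2 subtracted: the hypothesis says that the derivative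
    of this function has the sign opposite to that of z - u. Stating it with
    increments of g allows g to be merely Lipschitz. *)
Lemma taylor2_le (G g : R -> R) (k u v : R) :
  (forall x : R, is_derive x 1 G (g x)) ->
  (forall z, Num.min u v <= z <= Num.max u v ->
     (g z - g u - k * (z - u)) * (z - u) <= 0) ->
  G v - G u - g u * (v - u) <= k / 2 * (v - u) ^+ 2.
Proof.
move=> dG gk.
pose P := fun z : R => G z - g u * z - k / 2 * (z - u) ^+ 2.
have dP (z : R) : is_derive z 1 P (g z - g u - k * (z - u)).
  have := dG z => ?; apply: is_derive_eq.
  by rewrite /GRing.scale /=; field.
have cP a b : {within `[a, b], continuous P}.
  apply: continuous_subspaceT => z.
  by apply: differentiable_continuous; apply/derivable1_diffP; case: (dP z).
suff : P v - P u <= 0 by rewrite /P; lra.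
have [uv|vu|->] := ltgtP u v; last by rewrite subrr.
- have [c] := MVT uv (fun z _ => dP z) (cP _ _).
  rewrite in_itv/= => /andP[uc cv] ->.
  have := gk c.
  rewrite min_l ?max_r ?(ltW uv)// (ltW uc) (ltW cv) => /(_ isT).
  by rewrite pmulr_lle0 ?subr_gt0// => ?; rewrite pmulr_lle0 ?subr_gt0.
- have [c] := MVT vu (fun z _ => dP z) (cP _ _).
  rewrite in_itv/= => /andP[vc cu] e.
  have := gk c.
  rewrite min_r ?max_l ?(ltW vu)// (ltW vc) (ltW cu) => /(_ isT).
  rewrite nmulr_lle0 ?subr_lt0// => h.
  by rewrite -oppr_ge0 opprB e mulr_ge0// subr_ge0 ltW.
Qed.

Lemma taylor2_ge (G g : R -> R) (k u v : R) :
  (forall x : R, is_derive x 1 G (g x)) ->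
  (forall z, Num.min u v <= z <= Num.max u v ->
     0 <= (g z - g u - k * (z - u)) * (z - u)) ->
  k / 2 * (v - u) ^+ 2 <= G v - G u - g u * (v - u).
Proof.
move=> dG gk.
have : (- G) v - (- G) u - (- g) u * (v - u) <= - k / 2 * (v - u) ^+ 2.
  by apply: taylor2_le => z /gk; rewrite !fctE; nra.
by rewrite !fctE; nra.
Qed.

Lemma is_derive1_slope_near (g : R -> R) (u l k : R) :
  is_derive u 1 g l -> k < l ->
  exists2 e : R, 0 < e & forall z, `|z - u| < e ->
    0 <= (g z - g u - k * (z - u)) * (z - u).
Proof.
move=> [dg Dg] kl.
have : h^-1 *: (g (h *: 1 + u) - g u) @[h --> 0^'] --> l by rewrite -Dg.
move=> /cvgr_gt /(_ _ kl) /nbhs_ballP[e /= e0 He].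
exists e => // z zu.
have [->|zNu] := eqVneq z u; first by rewrite !subrr mulr0.
have h0 : z - u != 0 by rewrite subr_eq0.
have /= := He (z - u); rewrite /ball/= sub0r normrN zu => /(_ isT h0).
rewrite /GRing.scale/= mulr1 subrK => H.
have -> : (g z - g u - k * (z - u)) * (z - u) =
   ((z - u)^-1 * (g z - g u) - k) * (z - u) ^+ 2 by field.
by rewrite mulr_ge0 ?sqr_ge0// subr_ge0 ltW.
Qed.

End Taylor.

(** * A potential whose second derivative is carried by a given closed set *)

Section Potential.
Variable R : realType.
Notation mu := (@lebesgue_measure R).

(** G is an antiderivative of g, which is a primitive of the indicator of a
    bounded part of A. So G is affine on the intervals that avoid A, its
    second derivative is at most 1, and near the density point x0 the second
    derivative is 1 on average. The constant 3/8 is half of 3/4; any number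
    strictly between 1/3 and 1/2 would serve for the failure of convexity. *)
Lemma density_potential (A : set R) : closed A -> (0 < mu A)%E ->
  exists (G g : R -> R) (x0 e : R),
    [/\ continuous G,
        forall u v, `[Num.min u v, Num.max u v] `<=` ~` A ->
          G v - G u - g u * (v - u) <= 0,
        forall u v, G v - G u - g u * (v - u) <= (v - u) ^+ 2 / 2,
        0 < e &
        forall v, `|v - x0| < e ->
          3 / 8 * (v - x0) ^+ 2 <= G v - G x0 - g x0 * (v - x0)].
Proof.
move=> cA posA; have mA := closed_measurable cA.
have [n posAn] := exists_bounded_part_pos mA posA.
have mAn : measurable (A `&` `[- n%:R, n%:R]) by exact: measurableI.
have [|g [a [x0 [g1 gA ga gx0]]]] := indicator_primitive mAn posAn.
  by exists n => x [].
have cg : continuous g.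
  move=> x; apply/cvgrPdist_lt => e e0; apply/nbhs_ballP; exists e => //= y.
  rewrite /ball/= => xy; apply: le_lt_trans xy.
  have [le_xy|/ltW le_yx] := leP x y; last first.
    by rewrite !ger0_norm ?subr_ge0//; have /andP[] := g1 _ _ le_yx; lra.
  rewrite !(distrC x) (distrC (g x)).
  by rewrite !ger0_norm ?subr_ge0//; have /andP[] := g1 _ _ le_xy; lra.
have [G dG] := antiderivative_of_left_vanishing cg ga.
have k34 : 3 / 4 < 1 :> R by lra.
have [e e0 He] := is_derive1_slope_near gx0 k34.
exists G, g, x0, e; split => //.
- move=> x; apply: differentiable_continuous.
  by apply/derivable1_diffP; case: (dG x).
- move=> u v uvA; have := @taylor2_le _ G g 0 u v dG; rewrite !mul0r; apply.
  move=> z /andP[mz zM].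
  suff -> : g z = g u by rewrite mul0r subr0 subrr mul0r.
  have hull x : Num.min u z <= x <= Num.max u z ->
      (~` (A `&` `[- n%:R, n%:R])) x.
    move=> /andP[ux xz] [Ax _]; apply: (uvA x) => //=; rewrite in_itv/=.
    apply/andP; split.
      by apply: le_trans ux; rewrite le_min mz ge_min lexx.
    by apply: (le_trans xz); rewrite ge_max zM le_max lexx.
  have [uz|/ltW zu] := leP u z.
    apply/esym/gA => // x; rewrite /= in_itv/= => ux; apply: hull.
    by rewrite min_l ?max_r.
  apply: gA => // x; rewrite /= in_itv/= => ux; apply: hull.
  by rewrite min_r ?max_l.
- move=> u v; rewrite -[leRHS]mulrC -[2^-1]mul1r.
  apply: taylor2_le => // z _.
  have [uz|/ltW zu] := leP u z.
    by have /andP[? ?] := g1 _ _ uz; nra.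
  by have /andP[? ?] := g1 _ _ zu; nra.
- move=> v ve; have -> : 3 / 8 = 3 / 4 / 2 :> R by lra.
  apply: taylor2_ge => // z /andP[mz zM]; apply: He; apply: le_lt_trans ve.
  have [x0v|/ltW vx0] := leP x0 v.
    rewrite min_l// in mz; rewrite max_r// in zM.
    by rewrite !ger0_norm ?subr_ge0//; lra.
  rewrite min_r// in mz; rewrite max_l// in zM.
  by rewrite !ler0_norm ?subr_le0//; lra.
Qed.

End Potential.

(** * Convexity of functions of several variables *)

Section Convexity.
Variables (R : realType) (d : nat).

Lemma rV_convE (t : {i01 R}) (x y : convex_lmodType 'rV[R]_d) i :
  (conv t x y : 'rV[R]_d) 0 i =
    t%:num * (x : 'rV[R]_d) 0 i + (1 - t%:num) * (y : 'rV[R]_d) 0 i.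
Proof. by rewrite /conv/= !mxE. Qed.

(** Average, with the weights of z = t x + (1 - t) y, the two inequalities
    given at x and at y by the subgradient at z: the linear terms cancel. *)
Lemma convex_function_subgradient (D : set 'rV[R]_d) (f : 'rV[R]_d -> R) :
  convex_set D ->
  (forall u, D u -> exists p : 'I_d -> R, forall v, D v ->
     f u + \sum_i p i * (v 0 i - u 0 i) <= f v) ->
  convex_function D f.
Proof.
move=> cD subg t x y xD yD.
have zD := cD x y t xD yD; set z := conv t x y in zD *.
rewrite inE in xD; rewrite inE in yD; rewrite inE in zD.
have [p pz] := subg z zD.
rewrite convRE.
have t0 : 0 <= t%:num by [].
have t1 : 0 <= 1 - t%:num by rewrite subr_ge0.
have /(ler_wpM2l t0) hx := pz x xD.
have /(ler_wpM2l t1) hy := pz y yD.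
have slope0 : t%:num * (\sum_i p i * (x 0 i - z 0 i)) +
    (1 - t%:num) * (\sum_i p i * (y 0 i - z 0 i)) = 0.
  rewrite !mulr_sumr -big_split big1 //= => i _.
  by rewrite /z rV_convE; ring.
apply: le_trans (lerD hx hy); rewrite -/z.
by rewrite !mulrDr addrACA slope0 addr0 -mulrDl addrC subrK mul1r.
Qed.

Lemma open_coord_ball (i : 'I_d) (c r : R) :
  open [set w : 'rV[R]_d | ball c r (w 0 i)].
Proof.
apply: (@open_comp _ _ (fun w : 'rV[R]_d => w 0 i) (ball c r)) => [w _|].
  exact: coord_continuous.
exact: ball_open.
Qed.

Lemma convex_coord_ball (i : 'I_d) (c r : R) :
  convex_set [set w : 'rV[R]_d | ball c r (w 0 i)].
Proof.
move=> x y t; rewrite !inE /ball/= rV_convE !ltr_distl.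
have t0 : 0 <= t%:num by [].
have t1 : t%:num <= 1 by [].
move: (t%:num) t0 t1 ((x : 'rV[R]_d) 0 i) ((y : 'rV[R]_d) 0 i) => s s0 s1 a b.
move=> /andP[? ?] /andP[? ?].
move: s0; rewrite le_eqVlt => /predU1P[<-|s0]; apply/andP; split; nra.
Qed.

End Convexity.

(** * The quadratic form perturbed by two potentials *)

Section PerturbedQuadratic.
Variable R : realType.

Definition perturbed_quadratic (G H : R -> R) (w : 'rV[R]_2) : R :=
  w 0 0 ^+ 2 + w 0 1 ^+ 2 + w 0 0 * w 0 1 - 3 / 2 * (G (w 0 0) + H (w 0 1)).

Lemma continuous_perturbed_quadratic (G H : R -> R) :
  continuous G -> continuous H -> continuous (perturbed_quadratic G H).
Proof.
move=> cG cH w.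
have c0 : (fun v : 'rV[R]_2 => v 0 0) @ w --> w 0 0 by exact: coord_continuous.
have c1 : (fun v : 'rV[R]_2 => v 0 1) @ w --> w 0 1 by exact: coord_continuous.
have cG0 : (fun v : 'rV[R]_2 => G (v 0 0)) @ w --> G (w 0 0).
  exact: (continuous_comp c0 (cG _)).
have cH1 : (fun v : 'rV[R]_2 => H (v 0 1)) @ w --> H (w 0 1).
  exact: (continuous_comp c1 (cH _)).
have csq :
    (fun v : 'rV[R]_2 => v 0 0 ^+ 2 + v 0 1 ^+ 2 + v 0 0 * v 0 1) @ w -->
    w 0 0 ^+ 2 + w 0 1 ^+ 2 + w 0 0 * w 0 1.
  exact: (cvgD (cvgD (cvgM c0 c0) (cvgM c1 c1)) (cvgM c0 c1)).
have c32 : (fun v : 'rV[R]_2 => 3 / 2 : R) @ w --> (3 / 2 : R).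
  exact: cst_continuous.
have cGH : (fun v : 'rV[R]_2 => 3 / 2 * (G (v 0 0) + H (v 0 1))) @ w -->
    3 / 2 * (G (w 0 0) + H (w 0 1)).
  exact: (cvgM c32 (cvgD cG0 cH1)).
exact: (cvgB csq cGH).
Qed.

Lemma sum_2coord (p : 'I_2 -> R) (u v : 'rV[R]_2) :
  \sum_i p i * (v 0 i - u 0 i) =
    p 0 * (v 0 0 - u 0 0) + p 1 * (v 0 1 - u 0 1).
Proof.
rewrite big_ord_recl big_ord1.
by have -> : lift ord0 ord0 = 1 :> 'I_2 by exact: val_inj.
Qed.

(** With a step (h, k), the Taylor remainder of the perturbed quadratic is
    h^2 + k^2 + h k minus 3/2 of the remainders of G and H. When one of these
    is nonpositive and the other at most half the square of its step, what is
    left dominates h^2 + h k + k^2/4 = (h + k/2)^2, or (h/2 + k)^2. The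
    coefficient 3/2 is the largest for which this works. *)
Lemma convex_perturbed_quadratic (G g H h : R -> R) (V : set 'rV[R]_2) :
  convex_set V ->
  (forall u v, G v - G u - g u * (v - u) <= (v - u) ^+ 2 / 2) ->
  (forall u v, H v - H u - h u * (v - u) <= (v - u) ^+ 2 / 2) ->
  (forall u v, V u -> V v ->
     G (v 0 0) - G (u 0 0) - g (u 0 0) * (v 0 0 - u 0 0) <= 0 \/
     H (v 0 1) - H (u 0 1) - h (u 0 1) * (v 0 1 - u 0 1) <= 0) ->
  convex_function V (perturbed_quadratic G H).
Proof.
move=> cV Gle Hle GH0; apply: convex_function_subgradient => // u Vu.
exists (fun i => if i == 0 then 2 * u 0 0 + u 0 1 - 3 / 2 * g (u 0 0)
                 else 2 * u 0 1 + u 0 0 - 3 / 2 * h (u 0 1)) => v Vv.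
rewrite sum_2coord /= /perturbed_quadratic.
have := GH0 u v Vu Vv.
have := Gle (u 0 0) (v 0 0); have := Hle (u 0 1) (v 0 1).
move: (u 0 0) (u 0 1) (v 0 0) (v 0 1) => a b c d; clear => Hq Gq.
have := sqr_ge0 ((c - a) + (d - b) / 2).
have := sqr_ge0 ((c - a) / 2 + (d - b)).
by move=> ? ? [] ?; nra.
Qed.

End PerturbedQuadratic.

(** * Products of closed sets of positive measure *)

Lemma closed_compl_ball (R : realType) (C : set R) (x : R) :
  closed C -> ~ C x -> exists2 r : R, 0 < r & ball x r `<=` ~` C.
Proof.
move=> cC xC; have /nbhs_ballP[r /= r0 rC] : nbhs x (~` C).
  by apply: open_nbhs_nbhs; split => //; exact: closed_openC.
by exists r.
Qed.

Lemma itv_subset_ball (R : realType) (c r u v : R) :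
  ball c r u -> ball c r v -> `[Num.min u v, Num.max u v] `<=` ball c r.
Proof.
rewrite /ball/= !ltr_distl => /andP[? ?] /andP[? ?] z.
rewrite /= in_itv/= ltr_distl; case: (leP u v) => _ /andP[? ?];
  by apply/andP; split; lra.
Qed.

Theorem theorem2 (R : realType) (A B : set R)
    (closedA : closed A) (closedB : closed B)
    (posA : (0 < lebesgue_measure A)%E) (posB : (0 < lebesgue_measure B)%E) :
  ~ c_removable (cartesian_product A B).
Proof.
have [G [g [x0 [d [cG G0 Gle d0 Gge]]]]] := density_potential closedA posA.
have [H [h [y0 [e [cH H0 Hle e0 Hge]]]]] := density_potential closedB posB.
move=> /(_ _ (continuous_perturbed_quadratic cG cH)) removable.
have loc : locally_convex_on (~` cartesian_product A B)
    (perturbed_quadratic G H).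
  move=> w /= wAB; have [wA|wA] := pselect (A (w 0 0)); last first.
    have [r r0 rA] := closed_compl_ball closedA wA.
    exists [set v | ball (w 0 0) r (v 0 0)]; split.
    - exact: open_coord_ball.
    - exact: convex_coord_ball.
    - exact: ballxx.
    - by move=> v /rA /= vA [].
    - apply: convex_perturbed_quadratic Gle Hle _.
        exact: convex_coord_ball.
      move=> u v ub vb; left; apply: G0.
      exact: subset_trans (itv_subset_ball ub vb) rA.
  have wB : ~ B (w 0 1) by move=> wB; apply: wAB; split.
  have [r r0 rB] := closed_compl_ball closedB wB.
  exists [set v | ball (w 0 1) r (v 0 1)]; split.
  - exact: open_coord_ball.
  - exact: convex_coord_ball.
  - exact: ballxx.
  - by move=> v /rB /= vB [].
  - apply: convex_perturbed_quadratic Gle Hle _.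
      exact: convex_coord_ball.
    move=> u v ub vb; right; apply: H0.
    exact: subset_trans (itv_subset_ball ub vb) rB.
have m0 : 0 < Num.min d e by rewrite lt_min d0.
pose s := Num.min d e / 2.
have s0 : 0 < s by rewrite divr_gt0.
have /andP[sd se] : (s < d) && (s < e).
  by rewrite -lt_min /s; lra.
pose pt (a b : R) : 'rV[R]_2 := \row_i (if i == 0 then a else b).
have [half halfE] : exists t : {i01 R}, t%:num = 2^-1 :> R.
  have h0 : 0 <= 2^-1 :> R by lra.
  have h1 : 2^-1 <= 1 :> R by lra.
  by exists (Itv01 h0 h1).
(* Midpoint convexity along (1, -1) with step s, against the growth of G and H
   at the density points: the second difference of the perturbed quadratic is
   at most 2 s^2 - (3/2) * 4 * (3/8) s^2 = - s^2/4. *)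
have := removable loc half (pt (x0 + s) (y0 - s)) (pt (x0 - s) (y0 + s)).
rewrite !inE => /(_ I I).
rewrite convRE /perturbed_quadratic !rV_convE !mxE /= halfE.
have -> : 2^-1 * (x0 + s) + (1 - 2^-1) * (x0 - s) = x0 by field.
have -> : 2^-1 * (y0 - s) + (1 - 2^-1) * (y0 + s) = y0 by field.
have near0 z : `|z + s - z| = s /\ `|z - s - z| = s.
  by split; [rewrite addrAC subrr add0r|rewrite addrAC subrr add0r normrN];
    rewrite gtr0_norm.
have := Gge (x0 + s); rewrite (near0 _).1 => /(_ sd).
have := Gge (x0 - s); rewrite (near0 _).2 => /(_ sd).
have := Hge (y0 + s); rewrite (near0 _).1 => /(_ se).
have := Hge (y0 - s); rewrite (near0 _).2 => /(_ se).
rewrite /unstable.onem; have := exprn_gt0 2 s0.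
nra.
Qed.
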